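(* Let $u,v,w$ be real numbers with $(u,v,w)\ne(0,0,0)$. For every integer $n\ge 1$, writing $a_m:=\mathcal T_m^{(3,u,u^2+2v)}$ for $m\ge 1$, $$\mathcal T_{n+1}^{(0,1,u)}=\frac{1}{n!}\mathbf Y_n\bigl(a_1,\,1!\,a_2,\,2!\,a_3,\,\dots,\,(n-1)!\,a_n\bigr) =\frac{1}{n!}\begin{vmatrix} a_1&-1&0&\cdots&0\\ a_2&a_1&-2&&\vdots\\ \vdots&&\ddots&\ddots&0\\ a_{n-1}&a_{n-2}&\cdots&a_1&-(n-1)\\ a_n&a_{n-1}&\cdots&a_2&a_1 \end{vmatrix},$$ where the $n\times n$ matrix has $(i,j)$ entry $a_{i-j+1}$ if $i\ge j$, entry $-i$ if $j=i+1$, and entry $0$ if $j>i+1$.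
   Context: For real numbers $a,b,c$, the generalized Tribonacci numbers $\mathcal T_n^{(a,b,c)}$ ($n\ge0$), with fixed real coefficients $u,v,w$, are defined by $\mathcal T_0^{(a,b,c)}=a$, $\mathcal T_1^{(a,b,c)}=b$, $\mathcal T_2^{(a,b,c)}=c$ and $\mathcal T_n^{(a,b,c)}=u\mathcal T_{n-1}^{(a,b,c)}+v\mathcal T_{n-2}^{(a,b,c)}+w\mathcal T_{n-3}^{(a,b,c)}$ for $n\ge 3$. The complete exponential Bell polynomials $\mathbf Y_n(x_1,\dots,x_n)$ are defined by the formal power series identity $\exp\left(\sum_{m=1}^\infty x_m\frac{t^m}{m!}\right)=1+\sum_{n=1}^\infty\mathbf Y_n(x_1,\dots,x_n)\frac{t^n}{n!}$. *)

(* Defs.v *)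
From HB Require Import structures.
From mathcomp Require Import all_boot all_order all_algebra.
From mathcomp Require Import mpoly.

Set Implicit Arguments.
Unset Strict Implicit.
Unset Printing Implicit Defensive.

Import GRing.Theory.
Local Open Scope ring_scope.

Fixpoint trib (R : pzRingType) (u v w a b c : R) (n : nat) : R :=
  match n with
  | 0 => a
  | 1 => b
  | 2 => c
  | ((k.+1 as l).+1 as m).+1 =>
      u * trib u v w a b c m + v * trib u v w a b c l + w * trib u v w a b c k
  end.

(* A formal power series f(t) over A is its coefficient sequence:
   [f n] is the coefficient of t^n. *)
Definition fps_one (A : pzRingType) (n : nat) : A := (n == 0)%:R.

Definition fps_mul (A : pzRingType) (f g : nat -> A) (n : nat) : A :=
  \sum_(i < n.+1) f i * g (n - i)%N.

Definition fps_pow (A : pzRingType) (f : nat -> A) (k : nat) : nat -> A :=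
  iter k (fps_mul f) (@fps_one A).

(* exp(f) = sum_k f^k / k!, meaningful only when [f 0 = 0]: then f^k is
   divisible by t^k, so only the terms k <= n contribute to t^n. *)
Definition fps_exp (K : fieldType) (A : algType K) (f : nat -> A) (n : nat) : A :=
  \sum_(k < n.+1) (k`!%:R : K)^-1 *: fps_pow f k n.

(* sum_(1 <= m <= n) x_m t^m / m!, the indeterminate x_m being 'X_(m-1).
   The omitted terms x_m t^m / m! with m > n do not affect the coefficient of
   t^n in the exponential; see [bellP]. *)
Definition bell_arg (K : fieldType) (n m : nat) : {mpoly K[n]} :=
  \sum_(i < n | i.+1 == m) (m`!%:R : K)^-1 *: 'X_i.

Definition bell (K : fieldType) (n : nat) : {mpoly K[n]} :=
  (n`!%:R : K) *: fps_exp (bell_arg K n) n.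

(* Y_n(x_1, ..., x_n), with x_m = [x (m-1)]. *)
Definition bellY (K : fieldType) (n : nat) (x : 'I_n -> K) : K :=
  (bell K n).@[x].

Lemma fps_pow_meval (K : fieldType) (n : nat) (x : 'I_n -> K)
    (f : nat -> {mpoly K[n]}) (g : nat -> K) (N : nat) :
  (forall m, (m <= N)%N -> (f m).@[x] = g m) ->
  forall k m, (m <= N)%N -> (fps_pow f k m).@[x] = fps_pow g k m.
Proof.
move=> fg; elim=> [|k IHk] m le_mN /=.
  by rewrite /fps_one rmorph_nat.
rewrite /fps_mul raddf_sum /=; apply: eq_bigr => i _.
have le_im : (i <= m)%N by rewrite -ltnS.
rewrite rmorphM /= fg ?(leq_trans le_im) // IHk //.
exact: leq_trans (leq_subr _ _) le_mN.
Qed.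

(* The generating function identity defining the Y_n:
   exp(sum_(m >= 1) x_m t^m / m!) = 1 + sum_(n >= 1) Y_n(x_1, ..., x_n) t^n / n! *)
Lemma bellP (K : fieldType) (x : nat -> K) :
  (forall n, n`!%:R != 0 :> K) ->
  fps_exp (fun m => if m is 0 then 0 else x m / m`!%:R : K^o) =1
  (fun n => if n is 0 then 1
            else bellY (fun i : 'I_n => x i.+1) / n`!%:R).
Proof.
move=> fact_neq0 n.
have -> : (if n is 0 then 1 else bellY (fun i : 'I_n => x i.+1) / n`!%:R)
    = bellY (fun i : 'I_n => x i.+1) / n`!%:R.
  case: n => // ; rewrite /bellY /bell /fps_exp big_ord1 /= !fact0 invr1 !scale1r.
  by rewrite /fps_one rmorph_nat mulr1.
rewrite /bellY /bell mevalZ mulrAC divff // mul1r /fps_exp raddf_sum /=.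
apply: eq_bigr => k _; rewrite mevalZ; congr (_ * _).
apply/esym/(fps_pow_meval (N := n)) => // -[|m] le_mn; rewrite /bell_arg.
  by rewrite big_pred0 // meval0.
rewrite (bigD1 (Ordinal le_mn)) //= big1 ?addr0 => [|i /andP[/eqP[im]]].
  by rewrite mevalZ mevalXU mulrC.
by rewrite -val_eqE /= im eqxx.
Qed.

(* Main.v *)
Require Import Defs.
From mathcomp Require Import all_boot all_order all_algebra.
From mathcomp Require Import reals ring.

Set Implicit Arguments.
Unset Strict Implicit.
Unset Printing Implicit Defensive.

Import Order.TTheory GRing.Theory Num.Theory.
Local Open Scope ring_scope.

(** The three quantities are the solution [e] of one and the same recurrence
      [e_0 = 1],  [(n+1) e_(n+1) = a_1 e_n + a_2 e_(n-1) + ... + a_(n+1) e_0],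
    which has a single solution in characteristic zero
    ([newton_recurrence_uniq]).

    - The numbers [(n-1)! a_n] turn the argument of the exponential that
      defines the Bell polynomials into [f(t) = sum_m a_m t^m / m], and the
      recurrence is the coefficient form of [t E' = (t f') E] for [E = exp f]
      ([fps_exp_recurrence]).

    - Let [h_n] be the Tribonacci number of index [n+1] with initial values
      0, 1, u.  If [x, y, z] are the roots of [X^3 - u X^2 - v X - w], then
      [h_n] is the complete homogeneous symmetric function of degree [n] in
      [x, y, z] and [a_n] is the power sum [x^n + y^n + z^n]; the recurrence
      is Newton's identity between the two.  The roots are avoided here: the
      convolution of [a] and [h] and the sequence [n h_n] satisfy the same
      inhomogeneous Tribonacci recurrence ([trib_newton]).

    - The recurrence says that the vector [(e_0, ..., e_(n-1))] is sent by the
      matrix of the theorem to [(0, ..., 0, n e_n)].  Replacing the first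
      column of the matrix by this image does not change the determinant,
      and what remains is triangular up to a shift ([det_newton]). *)

(** * The exponential of a power series *)

(** The coefficients of [f^k] up to [t^N] only see the truncation of [f] at
    [t^N]; this brings the powers of a series within the reach of the
    polynomial calculus. *)
Lemma fps_pow_poly (A : comNzRingType) (f : nat -> A) (N k n : nat) :
  (n <= N)%N -> fps_pow f k n = ((\poly_(i < N.+1) f i) ^+ k)`_n.
Proof.
elim: k n => [|k IHk] n le_nN; first by rewrite expr0 coef1.
rewrite exprS coefM /= /fps_mul; apply: eq_bigr => i _.
have le_iN : (i <= N)%N by rewrite (leq_trans _ le_nN) // -ltnS.
by rewrite coef_poly ltnS le_iN IHk // (leq_trans (leq_subr _ _)).
Qed.

(** Coefficient form of [(f^(k+1))' = (k+1) f' f^k]. *)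
Lemma fps_pow_deriv (A : comNzRingType) (f : nat -> A) (k n : nat) :
  fps_pow f k.+1 n.+1 *+ n.+1
    = (\sum_(i < n.+1) (f i.+1 *+ i.+1) * fps_pow f k (n - i)) *+ k.+1.
Proof.
rewrite (@fps_pow_poly _ _ n.+1) // -coef_deriv deriv_exp /= coefMn coefM.
congr (_ *+ _); apply: eq_bigr => i _.
have le_in : (i <= n)%N by rewrite -ltnS.
rewrite coef_deriv coef_poly !ltnS le_in (@fps_pow_poly _ _ n.+1) //.
exact: leq_trans (leq_subr _ _) (leqnSn n).
Qed.

Lemma fps_pow_valuation (A : pzRingType) (f : nat -> A) (k n : nat) :
  f 0 = 0 -> (n < k)%N -> fps_pow f k n = 0.
Proof.
move=> f0; elim: k n => // k IHk n le_nk /=.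
rewrite /fps_mul big_ord_recl f0 mul0r add0r big1 // => i _.
rewrite IHk ?mulr0 //= /bump /= add1n.
case: n i le_nk => [[]//|n] i le_nk.
by rewrite subSS (leq_ltn_trans (leq_subr _ _)).
Qed.

Lemma fps_exp_widen (K : fieldType) (A : algType K) (f : nat -> A) (n N : nat) :
  f 0 = 0 -> (n <= N)%N ->
  fps_exp f n = \sum_(k < N.+1) (k`!%:R : K)^-1 *: fps_pow f k n.
Proof.
move=> f0 le_nN; rewrite /fps_exp.
rewrite (big_ord_widen N.+1 (fun k => (k`!%:R : K)^-1 *: fps_pow f k n)) //.
rewrite big_mkcond; apply: eq_bigr => k _.
by case: ltnP => // lt_nk; rewrite fps_pow_valuation ?scaler0.
Qed.

(** Coefficient form of [(exp f)' = f' exp f]: term by term it is the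
    derivative of [f^(k+1) / (k+1)!], namely [f' f^k / k!]. *)
Lemma fps_exp_recurrence (K : fieldType) (A : comAlgType K) (f : nat -> A)
    (n : nat) :
  (forall m, m.+1%:R != 0 :> K) -> f 0 = 0 ->
  fps_exp f n.+1 *+ n.+1
    = \sum_(i < n.+1) (f i.+1 *+ i.+1) * fps_exp f (n - i).
Proof.
move=> char0 f0.
rewrite {1}/fps_exp big_ord_recl /= {1}/fps_one /= scaler0 add0r -sumrMnl.
transitivity (\sum_(k < n.+1) \sum_(i < n.+1)
   (k`!%:R : K)^-1 *: ((f i.+1 *+ i.+1) * fps_pow f k (n - i))).
  apply: eq_bigr => k _; rewrite scalerMnr.
  rewrite -[fps_mul _ _ _]/(fps_pow f k.+1 n.+1) fps_pow_deriv.
  rewrite -[X in _ *: X]scaler_nat scalerA factS natrM invfM mulrAC.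
  by rewrite mulVf // mul1r scaler_sumr.
rewrite exchange_big; apply: eq_bigr => i _ /=.
rewrite (fps_exp_widen f0 (leq_subr i n)) mulr_sumr.
by apply: eq_bigr => k _; rewrite scalerAr.
Qed.

(** * Newton's recurrence *)

Lemma newton_recurrence_uniq (R : idomainType) (c d e : nat -> R) :
  (forall m, m.+1%:R != 0 :> R) -> d 0 = e 0 ->
  (forall n, d n.+1 *+ n.+1 = \sum_(i < n.+1) c i * d (n - i)%N) ->
  (forall n, e n.+1 *+ n.+1 = \sum_(i < n.+1) c i * e (n - i)%N) ->
  d =1 e.
Proof.
move=> char0 de0 dS eS n; elim/ltn_ind: n => -[//|n] IHn.
apply: (mulfI (char0 n)); rewrite !mulr_natl dS eS; apply: eq_bigr => i _.
by rewrite IHn // ltnS leq_subr.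
Qed.

Lemma tribS (R : pzRingType) (u v w a b c : R) (n : nat) :
  trib u v w a b c n.+3 = u * trib u v w a b c n.+2 + v * trib u v w a b c n.+1
    + w * trib u v w a b c n.
Proof. by []. Qed.

(** With [P(t) = 1 - u t - v t^2 - w t^3], the sequence [a] on the left has
    [sum_(m >= 1) a_m t^m = - t P'(t) / P(t)] and the one on the right has
    generating function [t / P(t)]; the identity compares coefficients in
    [- t P' / P = (u + 2 v t + 3 w t^2) (t / P)]. *)
Lemma trib_power_sum (R : comPzRingType) (u v w : R) (n : nat) :
  trib u v w 3 u (u ^+ 2 + 2 * v) n.+2
    = u * trib u v w 0 1 u n.+2 + 2 * v * trib u v w 0 1 u n.+1
      + 3 * w * trib u v w 0 1 u n.
Proof.
elim/ltn_ind: n => -[|[|[|n]]] IHn; [by rewrite /=; ring.. | ].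
rewrite [LHS]tribS !IHn ?ltnS ?leqnSn //; last by rewrite -addn2 leq_addr.
by rewrite !tribS; ring.
Qed.

(** The convolution [S_n] on the right inherits from its second factor the
    relation [S_(n+3) = u S_(n+2) + v S_(n+1) + w S_n + a_(n+3)], the last
    term being what the initial values contribute; [n h_n] satisfies the same
    relation by [trib_power_sum]. *)
Lemma trib_newton (R : comPzRingType) (u v w : R) (n : nat) :
  trib u v w 0 1 u n.+1 *+ n
    = \sum_(i < n) trib u v w 3 u (u ^+ 2 + 2 * v) i.+1
                   * trib u v w 0 1 u (n - i).
Proof.
elim/ltn_ind: n => -[|[|[|n]]] IHn.
- by rewrite big_ord0 mulr0n.
- by rewrite big_ord1 /=; ring.
- by rewrite !big_ord_recr big_ord0 /=; ring.
have S0 := IHn n ltac:(by rewrite ltnS -addn2 leq_addr).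
have S1 := IHn n.+1 ltac:(by rewrite ltnS).
have S2 := IHn n.+2 ltac:(by []).
have := trib_power_sum u v w n.+1.
move: S0 S1 S2 {IHn}.
set T := trib u v w 0 1 u; set a := trib u v w 3 u _ => S0 S1 S2 aT.
have TS m : T m.+3 = u * T m.+2 + v * T m.+1 + w * T m by [].
(* All four convolutions are brought to the range [i <= n], where the
   recurrence applies to the second factor; [T 0 = 0] allows this for [S_n]. *)
pose s k := \sum_(i < n.+1) a i.+1 * T (n - i + k)%N.
have sS : s 3 = u * s 2 + v * s 1 + w * s 0.
  rewrite /s !mulr_sumr -!big_split; apply: eq_bigr => i _ /=.
  by rewrite addn3 addn2 addn1 addn0 TS; ring.
have shift k : \sum_(i < n.+1) a i.+1 * T (n + k - i)%N = s k.
  by apply: eq_bigr => i _; rewrite addnBAC // -ltnS.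
have {S0}S0 : T n.+1 *+ n = s 0.
  by rewrite S0 -shift big_ord_recr /= addn0 subnn mulr0 addr0.
have {S1}S1 : T n.+2 *+ n.+1 = s 1 by rewrite S1 -shift addn1.
have {S2}S2 : T n.+3 *+ n.+2 = s 2 + a n.+2.
  by rewrite S2 big_ord_recr /= -shift addn2 subSnn mulr1.
rewrite 2!big_ord_recr /=.
have -> : (n.+3 - n.+1 = 2)%N by rewrite !subSS (subSn (leqnSn n)) subSnn.
have := shift 3; rewrite addn3 => ->.
rewrite subSnn sS (_ : T 2 = u) // (_ : T 1 = 1) //.
have -> : s 2 = T n.+3 *+ n.+2 - a n.+2 by rewrite S2 addrK.
by rewrite -S1 -S0 aT [T n.+4]TS; ring.
Qed.

(** * The determinant *)

(** Cramer's rule for the recurrence seen as a triangular linear system: the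
    column [(e_0, ..., e_(n-1))], which starts with 1, is mapped by the matrix
    to [(0, ..., 0, n e_n)].  With this image as first column, the expansion
    along it leaves one minor, triangular with diagonal [-1, ..., -(n-1)], and
    the two signs cancel. *)
Lemma det_newton (R : comPzRingType) (c e : nat -> R) (n : nat) :
  e 0 = 1 ->
  (forall m, e m.+1 *+ m.+1 = \sum_(i < m.+1) c i * e (m - i)%N) ->
  \det (\matrix_(i < n, j < n)
          (if (j <= i)%N then c (i - j)%N
           else if (j == i.+1 :> nat) then - (i.+1)%:R
           else 0))
    = n`!%:R * e n.
Proof.
move=> e0 eS; case: n => [|n]; first by rewrite det_mx00 e0 mulr1.
set M := \matrix_(i, j) _.
(* Multiplying by [U] on the right replaces the first column by the image of
   [e]; [U] is unitriangular because [e 0 = 1]. *)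
pose U : 'M[R]_n.+1 :=
  \matrix_(i, j) (if j == ord0 then e i else (i == j)%:R).
have detU : \det U = 1.
  rewrite det_trig; last first.
    apply/is_trig_mxP => i j lt_ij; rewrite mxE -!val_eqE /=.
    by rewrite (gtn_eqF (leq_ltn_trans (leq0n i) lt_ij)) (ltn_eqF lt_ij).
  by rewrite big1 // => i _; rewrite mxE eqxx; case: eqP => // ->.
have MU0 i : (M *m U) i ord0 = (e n.+1 *+ n.+1) *+ (i == ord_max).
  rewrite mxE; under eq_bigr => j _ do rewrite !mxE eqxx.
  set F := fun k : nat => (if (k <= i)%N then c (i - k)%N
    else if k == i.+1 then - i.+1%:R else 0) * e k.
  have sumF : \sum_(k < i.+1) F k = e i.+1 *+ i.+1.
    rewrite eS (reindex_inj rev_ord_inj) /=; apply: eq_bigr => k _.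
    by rewrite /F subSS leq_subr subKn // -ltnS.
  have [i_eq | i_neq] := eqVneq i ord_max.
    have ni : i = n :> nat by rewrite i_eq.
    by rewrite mulr1n; rewrite ni in sumF.
  have lt_in : (i < n)%N.
    rewrite ltn_neqAle -ltnS ltn_ord andbT.
    by apply: contraNneq i_neq => ni; apply/eqP/val_inj.
  (* Above the last row, the superdiagonal entry cancels the rest of the
     row. *)
  transitivity (\sum_(k < i.+2) F k).
    rewrite [RHS](big_ord_widen n.+1 F) ?ltnS // [RHS]big_mkcond.
    apply: eq_bigr => k _ /=.
    case: (ltnP k i.+2) => //; rewrite /F => lt_ik.
    by rewrite leqNgt (ltnW lt_ik) gtn_eqF //= mul0r.
  by rewrite big_ord_recr /= sumF /F ltnn eqxx mulNr mulr_natl subrr.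
have MUS i j : j != ord0 -> (M *m U) i j = M i j.
  move=> j0; rewrite mxE (bigD1 j) //= big1 => [|k kj].
    by rewrite [U _ _]mxE (negPf j0) eqxx mulr1 addr0.
  by rewrite [U _ _]mxE (negPf j0) (negPf kj) mulr0.
have -> : \det M = \det (M *m U) by rewrite det_mulmx detU mulr1.
rewrite (expand_det_col _ ord0) (bigD1 ord_max) //= big1 ?addr0 => [|i im].
  have minorE (i j : 'I_n) :
      row' ord_max (col' ord0 (M *m U)) i j = M (lift ord_max i) (lift ord0 j).
    by rewrite [LHS]mxE [LHS]mxE MUS // eq_sym neq_lift.
  rewrite MU0 eqxx mulr1n /cofactor det_trig; last first.
    apply/is_trig_mxP => i j lt_ij; rewrite minorE mxE lift_max lift0.
    by rewrite leqNgt (leq_trans lt_ij) //= eqSS gtn_eqF.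
  under eq_bigr => i _.
    rewrite minorE mxE lift_max lift0 ltnn eqxx -mulN1r; over.
  rewrite big_split prodr_const card_ord /= addn0.
  have -> : \prod_(i < n) i.+1%:R = n`!%:R :> R.
    by rewrite -natr_prod fact_prod big_add1 big_mkord.
  rewrite signrMK factS natrM.
  by rewrite -[e n.+1 *+ _]mulr_natl mulrAC.
by rewrite MU0 (negPf im) mul0r.
Qed.

(** * The three expressions *)

Theorem theorem4 (R : realType) (u v w : R) (n : nat) :
  (u, v, w) <> (0, 0, 0) ->
  (1 <= n)%N ->
  let a (m : nat) : R := trib u v w 3 u (u ^+ 2 + 2 * v) m in
  trib u v w 0 1 u n.+1
    = (n`!%:R)^-1 * bellY (fun i : 'I_n => i`!%:R * a i.+1)
  /\
  (n`!%:R)^-1 * bellY (fun i : 'I_n => i`!%:R * a i.+1)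
    = (n`!%:R)^-1 *
      \det (\matrix_(i < n, j < n)
              (if (j <= i)%N then a (i - j).+1
               else if (j == i.+1 :> nat) then - (i.+1)%:R
               else 0)).
Proof.
move=> _ n_gt0 a.
have char0 m : m.+1%:R != 0 :> R by rewrite pnatr_eq0.
have fact_neq0 m : m`!%:R != 0 :> R by rewrite pnatr_eq0 -lt0n fact_gt0.
(* [x] is indexed from 1, as the arguments of the Bell polynomials are. *)
pose x m : R := m.-1`!%:R * a m.
pose f m : R^o := if m is 0 then 0 else x m / m`!%:R.
have bell_exp : (n`!%:R)^-1 * bellY (fun i : 'I_n => i`!%:R * a i.+1)
    = fps_exp f n.
  by rewrite (bellP x fact_neq0) mulrC; case: n n_gt0.
pose h m := trib u v w 0 1 u m.+1.
have hS m : h m.+1 *+ m.+1 = \sum_(i < m.+1) a i.+1 * h (m - i)%N.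
  rewrite trib_newton; apply: eq_bigr => i _.
  by rewrite subSn // -ltnS.
have expS m :
    fps_exp f m.+1 *+ m.+1 = \sum_(i < m.+1) a i.+1 * fps_exp f (m - i).
  rewrite fps_exp_recurrence //; apply: eq_bigr => i _; congr (_ * _).
  rewrite /f /x /= factS natrM -[LHS]mulr_natl.
  move: (char0 i) (fact_neq0 i).
  move: (i.+1%:R) (i`!%:R) => p q p0 q0.
  by field; rewrite p0 q0.
have exp0 : fps_exp f 0 = 1.
  by rewrite /fps_exp big_ord1 invr1 scale1r.
have exp_h : fps_exp f =1 h.
  by apply: (newton_recurrence_uniq (c := fun i => a i.+1)).
rewrite bell_exp exp_h; split=> //.
rewrite (det_newton (c := fun i => a i.+1) (e := h)) //.
by rewrite mulKf.
Qed.
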